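(* Let $n>2$ and $p>n$. If $\Phi\in L^p(\mathbb{R}^n,\Lambda\mathbb{R}^n)$, then $\mathcal{C}^+\Phi$ is Hölder continuous with Hölder exponent $\alpha=1-\frac np$.
   Context: $\Lambda\mathbb{R}^n$ is the exterior algebra with induced inner product; for a vector $v$ and multivector $w$, $v\triangle w=v\lrcorner w+v\wedge w$ (Euclidean Clifford product), where $\langle v\lrcorner w_1,w_2\rangle=\langle w_1,v\wedge w_2\rangle$. The Cauchy transform is $$\mathcal{C}^+\Phi(x)=\frac{1}{\sigma_{n-1}}\int_{\mathbb{R}^n}\frac{y-x}{|y-x|^n}\triangle\Phi(y)\,dy$$ for $\Phi\in C_0^\infty(\mathbb{R}^n,\Lambda\mathbb{R}^n)$, with $\sigma_{n-1}$ the area of the unit sphere $\mathbb{S}^{n-1}$. For $\Phi\in L^p$ with $p>n$ it is understood modulo additive constants, through the differences $\mathcal{C}^+\Phi(x)-\mathcal{C}^+\Phi(x')=\frac1{\sigma_{n-1}}\int_{\mathbb{R}^n}\Big(\frac{y-x}{|y-x|^n}-\frac{y-x'}{|y-x'|^n}\Big)\triangle\Phi(y)\,dy$. *)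

(* Defs.v *)
From HB Require Import structures.
From mathcomp Require Import all_boot all_order all_algebra.
From mathcomp Require Import all_classical all_reals all_analysis.

Set Implicit Arguments.
Unset Strict Implicit.
Unset Printing Implicit Defensive.

Import Order.TTheory GRing.Theory Num.Theory.
Import numFieldNormedType.Exports.

Local Open Scope classical_set_scope.
Local Open Scope ring_scope.

(** * Euclidean space: ['rV[R]_n] with the Borel (= product) sigma-algebra *)

Definition rV_display : measure_display.
Proof. exact: measure_tuple_display default_measure_display. Qed.

Section measurable_rV.
Variables (R : realType) (n : nat).

Definition rV_coord (i : 'I_n) (x : 'rV[R]_n) : measurableTypeR R := x ord0 i.

Let rV_set0 : g_sigma_preimage rV_coord set0.
Proof. exact: sigma_algebra0. Qed.

Let rV_setC A : g_sigma_preimage rV_coord A -> g_sigma_preimage rV_coord (~` A).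
Proof. exact: sigma_algebraC. Qed.

Let rV_bigcup (F : (set 'rV[R]_n)^nat) :
  (forall i, g_sigma_preimage rV_coord (F i)) ->
  g_sigma_preimage rV_coord (\bigcup_i (F i)).
Proof. exact: sigma_algebra_bigcup. Qed.

HB.instance Definition _ := @isMeasurable.Build rV_display
  'rV[R]_n (g_sigma_preimage rV_coord) rV_set0 rV_setC rV_bigcup.

Lemma measurable_rV_coord (i : 'I_n) : measurable_fun setT (rV_coord i).
Proof.
move=> _ Y mY; rewrite setTI; apply: sub_sigma_algebra => /=.
rewrite -bigcup_seq/=; exists i => /=; first by rewrite mem_index_enum.
by exists Y => //; rewrite setTI.
Qed.

Lemma measurable_fun_rVP d (T : measurableType d) (f : T -> 'rV[R]_n) :
  (forall i, measurable_fun setT (rV_coord i \o f)) -> measurable_fun setT f.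
Proof.
move=> mf _ A mA; rewrite setTI.
pose B : set (set 'rV[R]_n) := [set A | measurable (f @^-1` A)].
suff : measurable `<=` B by apply.
apply: smallest_sub.
  split=> [|C mC|F mF]; rewrite /B/= ?preimage_set0 ?setTD//.
    by rewrite preimage_setC; exact: measurableC.
  by rewrite preimage_bigcup; exact: bigcupT_measurable.
move=> C; rewrite -bigcup_seq/= => -[i _ [D mD <-]]; rewrite /B/= setTI.
by have := mf i measurableT D mD; rewrite setTI comp_preimage.
Qed.

End measurable_rV.

(** * Lebesgue measure on ['rV[R]_n] *)

Section lebesgue_rV.
Variable R : realType.

Definition rV_cons n (z : measurableTypeR R * 'rV[R]_n) : 'rV[R]_n.+1 :=
  row_mx (z.1)%:M z.2 : 'rV[R]_(1 + n).

Lemma rV_consE0 n (z : measurableTypeR R * 'rV[R]_n) :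
  rV_cons z ord0 ord0 = z.1.
Proof.
rewrite (_ : ord0 = @lshift 1 n ord0); last exact/val_inj.
by rewrite [LHS]row_mxEl mxE eqxx mulr1n.
Qed.

Lemma rV_consES n (z : measurableTypeR R * 'rV[R]_n) (i : 'I_n) :
  rV_cons z ord0 (lift ord0 i) = z.2 ord0 i.
Proof.
rewrite (_ : lift ord0 i = @rshift 1 n i); last exact/val_inj.
by rewrite [LHS]row_mxEr.
Qed.

Lemma measurable_rV_cons n : measurable_fun setT (@rV_cons n).
Proof.
apply: measurable_fun_rVP => i; case: (unliftP ord0 i) => [j ->|->].
  rewrite (_ : _ \o _ = @rV_coord R n j \o snd); last first.
    by apply/funext => z; rewrite /= /rV_coord rV_consES.
  exact: measurableT_comp (measurable_rV_coord j) _.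
rewrite (_ : _ \o _ = fst) //.
by apply/funext => z; rewrite /= /rV_coord rV_consE0.
Qed.

Lemma rV_consK n (x : 'rV[R]_n.+1) :
  rV_cons (x ord0 ord0, \row_j x ord0 (lift ord0 j)) = x.
Proof.
apply/rowP => i; case: (unliftP ord0 i) => [j ->|->].
  by rewrite rV_consES mxE.
by rewrite rV_consE0.
Qed.

Lemma measurable_rV_uncons n : measurable_fun setT
  (fun x : 'rV[R]_n.+1 =>
     (x ord0 ord0 : measurableTypeR R, \row_j x ord0 (lift ord0 j) : 'rV[R]_n)).
Proof.
apply/measurable_fun_pairP; split; first exact: measurable_rV_coord.
apply: measurable_fun_rVP => i.
rewrite (_ : _ \o _ = @rV_coord R n.+1 (lift ord0 i)).
  exact: measurable_rV_coord.
by apply/funext => x; rewrite /= /rV_coord mxE.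
Qed.

Section step.
Variables (n : nat) (mu : {sigma_finite_measure set 'rV[R]_n -> \bar R}).

Definition lebesgue_rV_step : set 'rV[R]_n.+1 -> \bar R :=
  pushforward (lebesgue_measure \x mu)%E (@rV_cons n).

Let step_measurable A : measurable A -> measurable (@rV_cons n @^-1` A).
Proof.
by move=> mA; rewrite -[X in measurable X]setTI; exact: measurable_rV_cons.
Qed.

Let step0 : lebesgue_rV_step set0 = 0%E.
Proof. by rewrite /lebesgue_rV_step/pushforward preimage_set0 measure0. Qed.

Let step_ge0 A : (0 <= lebesgue_rV_step A)%E.
Proof. by rewrite /lebesgue_rV_step/pushforward measure_ge0. Qed.

Let step_sigma_additive : semi_sigma_additive lebesgue_rV_step.
Proof.
move=> F mF tF mUF; rewrite /lebesgue_rV_step/pushforward preimage_bigcup.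
apply: measure_semi_sigma_additive.
- by move=> k; exact: step_measurable.
- apply/trivIsetP => /= i j _ _ ij; rewrite -preimage_setI.
  by move/trivIsetP : tF => /(_ _ _ _ _ ij) ->//; rewrite preimage_set0.
- by rewrite -preimage_bigcup; exact: step_measurable.
Qed.

HB.instance Definition _ := isMeasure.Build _ _ _
  lebesgue_rV_step step0 step_ge0 step_sigma_additive.

Let step_sigma_finite : sigma_finite setT lebesgue_rV_step.
Proof.
have /sigma_finiteP[F [FT ndF Foo]] := sigma_finiteT (@lebesgue_measure R).
have /sigma_finiteP[G [GT ndG Goo]] := sigma_finiteT mu.
pose g (x : 'rV[R]_n.+1) :=
  (x ord0 ord0 : measurableTypeR R, \row_j x ord0 (lift ord0 j) : 'rV[R]_n).
have gK : g \o @rV_cons n = id.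
  apply/funext => -[a v]; rewrite /g /= rV_consE0; congr pair.
  by apply/rowP => j; rewrite mxE rV_consES.
exists (fun k => g @^-1` (F k `*` G k)).
  apply/seteqP; split=> // x _.
  have : [set: measurableTypeR R] (g x).1 by [].
  have : [set: 'rV[R]_n] (g x).2 by [].
  rewrite FT GT => -[k _ Gk] [l _ Fl]; exists (maxn k l) => //; split.
    by move: Fl; exact/subsetPset/ndF/leq_maxr.
  by move: Gk; exact/subsetPset/ndG/leq_maxl.
move=> k; have [mF Fk] := Foo k; have [mG Gk] := Goo k; split.
  rewrite -[X in measurable X]setTI; apply: measurable_rV_uncons => //.
  exact: measurableX.
rewrite /lebesgue_rV_step/pushforward -comp_preimage gK preimage_id.
by rewrite product_measure1E// lte_mul_pinfty// ge0_fin_numE.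
Qed.

HB.instance Definition _ := Measure_isSigmaFinite.Build _ _ _
  lebesgue_rV_step step_sigma_finite.

End step.

Fixpoint lebesgue_rV n : {sigma_finite_measure set 'rV[R]_n -> \bar R} :=
  if n is m.+1 then lebesgue_rV_step (lebesgue_rV m) else \d_(0 : 'rV[R]_0).

Lemma lebesgue_rV_box n (A : 'I_n -> set (measurableTypeR R)) :
  (forall i, measurable (A i)) ->
  lebesgue_rV n [set x | forall i, A i (x ord0 i)] =
  (\prod_(i < n) lebesgue_measure (A i))%E.
Proof.
elim: n A => [|n IH] A mA.
  rewrite big_ord0 /= diracE mem_set//= => -[]//.
rewrite big_ord_recl -IH => [|i]; last exact: mA.
rewrite -product_measure1E//; last first.
  rewrite [X in measurable X](_ : _ = \bigcap_(i in [set: 'I_n])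
      (@rV_coord R n i @^-1` A (lift ord0 i))).
    apply: fin_bigcap_measurable => //= i _.
    by rewrite -[X in measurable X]setTI; exact: measurable_rV_coord.
  by apply/seteqP; split=> x /= Ax; [move=> i _; exact: Ax|move=> i; exact: Ax].
rewrite /= /lebesgue_rV_step/pushforward; congr (_ _).
apply/seteqP; split=> z /= Az.
  split; first by have := Az ord0; rewrite rV_consE0.
  by move=> i; have := Az (lift ord0 i); rewrite rV_consES.
case: Az => A0 AS i; case: (unliftP ord0 i) => [j ->|->].
  by rewrite rV_consES.
by rewrite rV_consE0.
Qed.

End lebesgue_rV.

(** * Euclidean norm, Hausdorff measure, area of the unit sphere *)

Section euclidean.
Variables (R : realType) (n : nat).

(* The norm [`|x|] that the library puts on ['rV[R]_n] is the sup norm. *)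
Definition enorm (x : 'rV[R]_n) : R := Num.sqrt (\sum_(i < n) x ord0 i ^+ 2).

Definition ediam (A : set 'rV[R]_n) : \bar R :=
  ereal_sup (0%E |` [set (enorm (x - y))%:E | x in A & y in A]).

Definition unit_ball_volume : \bar R :=
  lebesgue_rV R n [set x : 'rV[R]_n | enorm x <= 1].

End euclidean.

Section hausdorff.
Variables (R : realType) (n : nat).

(* Hausdorff measure of integer dimension [s >= 1], normalised so that it
   agrees with [s]-dimensional area on [s]-dimensional submanifolds: a set of
   diameter [d] is charged the volume of an [s]-dimensional ball of diameter
   [d]. *)
Definition hausdorff_content (s : nat) (delta : R) (A : set 'rV[R]_n) : \bar R :=
  ereal_inf [set (\sum_(0 <= i <oo)
                    unit_ball_volume R s * ((2^-1)%R%:E * ediam (U i)) ^+ s)%E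
            | U in [set U : (set 'rV[R]_n)^nat |
                A `<=` \bigcup_i U i /\ forall i, (ediam (U i) <= delta%:E)%E]].

Definition hausdorff_measure (s : nat) (A : set 'rV[R]_n) : \bar R :=
  ereal_sup [set hausdorff_content s delta A | delta in [set d : R | 0 < d]].

(* sigma_(n-1) *)
Definition sphere_area : R :=
  fine (hausdorff_measure n.-1 [set x : 'rV[R]_n | enorm x = 1]).

End hausdorff.

(** * The exterior algebra of R^n *)

(* A multivector is given by its coordinates in the basis [e_S], [S] a subset
   of ['I_n], where [e_S] is the wedge product of the [e_i], [i] in [S], taken
   in increasing order.  This basis is orthonormal for the induced inner
   product. *)
Notation multivector R n := {ffun {set 'I_n} -> R^o}.

Section exterior.
Variables (R : realType) (n : nat).
Implicit Types (v : 'rV[R]_n) (u w : multivector R n) (S T : {set 'I_n}).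

Definition mvbasis S : multivector R n := [ffun T => (T == S)%:R].

Definition mvvec v : multivector R n := \sum_(i < n) v ord0 i *: mvbasis [set i].

Definition mvinner u w : R := \sum_(S : {set 'I_n}) u S * w S.

Definition mvnorm u : R := Num.sqrt (mvinner u u).

(* For disjoint [S] and [T], [e_S /\ e_T = (-1)^inversions S T e_(S :|: T)]. *)
Definition inversions S T : nat :=
  #|[set ij in finset.setX S T | (ij.2 < ij.1)%N]|.

Definition wedge u w : multivector R n :=
  [ffun U : {set 'I_n} => \sum_(S : {set 'I_n} | S \subset U)
     (-1) ^+ inversions S (U :\: S)%SET * u S * w (U :\: S)%SET].

(* The coordinates that the duality [contraction_adjoint] prescribes. *)
Definition contraction u w : multivector R n :=
  [ffun S => mvinner w (wedge u (mvbasis S))].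

Definition clifford v w : multivector R n :=
  contraction (mvvec v) w + wedge (mvvec v) w.

Lemma contraction_adjoint u w1 w2 :
  mvinner (contraction u w1) w2 = mvinner w1 (wedge u w2).
Proof.
transitivity (\sum_T \sum_U w1 U * wedge u (mvbasis T) U * w2 T).
  by apply: eq_bigr => T _; rewrite ffunE /mvinner mulr_suml.
rewrite exchange_big; apply: eq_bigr => U _ /=.
under eq_bigr do rewrite -mulrA.
rewrite -mulr_sumr; congr (_ * _); rewrite [RHS]ffunE.
under eq_bigr do rewrite ffunE mulr_suml.
rewrite exchange_big; apply: eq_bigr => S _ /=.
rewrite (bigD1 (U :\: S)%SET) //= ffunE eqxx mulr1 big1 ?addr0// => T TUS.
by rewrite ffunE eq_sym (negbTE TUS) mulr0 mul0r.
Qed.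

End exterior.

(** * The Cauchy transform *)

Section cauchy_transform.
Variables (R : realType) (n : nat).
Let mu := lebesgue_rV R n.
Implicit Types (Phi : 'rV[R]_n -> multivector R n) (x y : 'rV[R]_n).

Definition mvintegrable (f : 'rV[R]_n -> multivector R n) : Prop :=
  forall S, mu.-integrable setT (fun y => (f y S)%:E).

Definition mvintegral (f : 'rV[R]_n -> multivector R n) : multivector R n :=
  [ffun S => \int[mu]_(y in setT) f y S].

Definition mvLp (p : R) Phi : Prop :=
  (forall S, measurable_fun setT (fun y => Phi y S : measurableTypeR R)) /\
  (fun y => mvnorm (Phi y)) \in Lfun mu p%:E.

Definition cauchy_kernel x y : 'rV[R]_n := enorm (y - x) ^- n *: (y - x).

Definition cauchy_diff_integrand Phi x x' y : multivector R n :=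
  clifford (cauchy_kernel x y - cauchy_kernel x' y) (Phi y).

(* [F] represents the Cauchy transform of [Phi], which is only defined modulo
   additive constants: its differences are given by the (absolutely convergent)
   integrals of differences of kernels. *)
Definition is_cauchy_transform Phi (F : 'rV[R]_n -> multivector R n) : Prop :=
  forall x x', mvintegrable (cauchy_diff_integrand Phi x x') /\
    F x - F x' =
    (sphere_area R n)^-1 *: mvintegral (cauchy_diff_integrand Phi x x').

Definition holder_continuous (alpha : R) (F : 'rV[R]_n -> multivector R n) :=
  exists C : R, forall x x',
    mvnorm (F x - F x') <= C * enorm (x - x') `^ alpha.

End cauchy_transform.

(* Main.v *)
(* Let q be the exponent conjugate to p and set r = |x - x'|.  By Hoelder's
   inequality the integral of |Phi| over a ball of radius rho is at most
   M rho^(n/q), where n/q = n - n/p, because the volume of the ball is at most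
   (2 rho)^n.  Cut the integral of |K(x,y) - K(x',y)| |Phi(y)| into dyadic
   shells.  On the shells of radius rho <= 4r around x and x' each kernel is
   at most (rho/2)^(1-n), so such a shell contributes O(rho^(1-n/p)); on the
   shells of radius rho >= 4r around x the mean value estimate
   |K(x,y) - K(x',y)| <= C r |y-x|^(-n) gives a contribution of
   O(r rho^(-n/p)).  Both are geometric series with sum O(r^(1-n/p)), the first
   because p > n. *)
Require Import Defs.
From mathcomp Require Import all_boot all_order all_algebra.
From mathcomp Require Import all_classical all_reals all_analysis.
From mathcomp Require Import measurable_realfun ring lra.

Set Implicit Arguments.
Unset Strict Implicit.
Unset Printing Implicit Defensive.

Import Order.TTheory GRing.Theory Num.Theory.

Local Open Scope classical_set_scope.
Local Open Scope ring_scope.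

(** * The Euclidean norm *)

Lemma enorm_ge0 (R : realType) (n : nat) (x : 'rV[R]_n) : 0 <= enorm x.
Proof. exact: sqrtr_ge0. Qed.

Lemma sqr_enorm (R : realType) (n : nat) (x : 'rV[R]_n) :
  enorm x ^+ 2 = \sum_(i < n) x ord0 i ^+ 2.
Proof. by rewrite sqr_sqrtr// sumr_ge0// => i _; exact: sqr_ge0. Qed.

Lemma coord_le_enorm (R : realType) (n : nat) (x : 'rV[R]_n) (i : 'I_n) :
  `|x ord0 i| <= enorm x.
Proof.
rewrite -(ler_pXn2r (_ : 0 < 2)%N) ?nnegrE ?enorm_ge0// sqr_enorm.
rewrite real_normK ?num_real//.
by rewrite (bigD1 i)//= lerDl sumr_ge0// => j _; exact: sqr_ge0.
Qed.

Lemma enormZ (R : realType) (n : nat) (c : R) (x : 'rV[R]_n) :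
  enorm (c *: x) = `|c| * enorm x.
Proof.
rewrite /enorm -sqrtr_sqr -sqrtrM ?sqr_ge0//; congr Num.sqrt.
by rewrite mulr_sumr; apply: eq_bigr => i _; rewrite mxE exprMn.
Qed.

Lemma enormN (R : realType) (n : nat) (x : 'rV[R]_n) : enorm (- x) = enorm x.
Proof. by rewrite -scaleN1r enormZ normrN1 mul1r. Qed.

Lemma enorm0 (R : realType) (n : nat) : enorm (0 : 'rV[R]_n) = 0.
Proof. by rewrite -(scale0r 0) enormZ normr0 mul0r. Qed.

Lemma enorm_eq0 (R : realType) (n : nat) (x : 'rV[R]_n) :
  (enorm x == 0) = (x == 0).
Proof.
apply/eqP/eqP => [x0|->]; last exact: enorm0.
apply/rowP => i; apply/eqP; rewrite mxE -normr_le0 -x0; exact: coord_le_enorm.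
Qed.

(** For nonzero vectors, multiplying both sides by [2 * (enorm x * enorm y)] turns the difference
    into the sum of the squares of [x_i |y| - y_i |x|]. *)
Lemma enorm_cauchy_schwarz (R : realType) (n : nat) (x y : 'rV[R]_n) :
  \sum_(i < n) x ord0 i * y ord0 i <= enorm x * enorm y.
Proof.
have [->|x0] := eqVneq x 0.
  by rewrite enorm0 mul0r big1// => i _; rewrite mxE mul0r.
have [->|y0] := eqVneq y 0.
  by rewrite enorm0 mulr0 big1// => i _; rewrite mxE mulr0.
have xy0 : 0 < enorm x * enorm y.
  by rewrite mulr_gt0// lt_neqAle eq_sym enorm_ge0 enorm_eq0 ?x0 ?y0.
rewrite -(ler_pM2l xy0) -(ler_pM2l (_ : 0 < 2))//.
rewrite [leRHS](_ : _ = enorm x ^+ 2 * enorm y ^+ 2 +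
  enorm x ^+ 2 * enorm y ^+ 2); last by ring.
rewrite {1}(sqr_enorm x) {2}(sqr_enorm y) mulr_suml !mulr_sumr -big_split/=.
apply: ler_sum => i _.
rewrite -subr_ge0 [leRHS](_ : _ =
  (x ord0 i * enorm y - y ord0 i * enorm x) ^+ 2); last by ring.
exact: sqr_ge0.
Qed.

Lemma enormD (R : realType) (n : nat) (x y : 'rV[R]_n) :
  enorm (x + y) <= enorm x + enorm y.
Proof.
rewrite -(ler_pXn2r (_ : 0 < 2)%N) ?nnegrE ?addr_ge0 ?enorm_ge0//.
rewrite sqrrD !sqr_enorm.
under eq_bigr do rewrite mxE sqrrD.
rewrite !big_split/= lerD2r lerD2l.
by rewrite mulr2n lerD// enorm_cauchy_schwarz.
Qed.

Lemma enorm_distC (R : realType) (n : nat) (x y : 'rV[R]_n) :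
  enorm (x - y) = enorm (y - x).
Proof. by rewrite -enormN opprB. Qed.

Lemma lerB_enorm (R : realType) (n : nat) (x y : 'rV[R]_n) :
  `|enorm x - enorm y| <= enorm (x - y).
Proof.
have := enormD (x - y) y; have := enormD (y - x) x.
rewrite !subrK (enorm_distC y x) ler_norml => h1 h2.
by apply/andP; split; lra.
Qed.

(** * Dyadic scales and differences of powers *)

Lemma dyadic_ge1 (R : realType) (t : R) : 1 <= t ->
  exists k : nat, 2 ^+ k <= t <= 2 ^+ k.+1.
Proof.
move=> t1; have t0 : 0 <= t by lra.
have m0 : (0 < Num.truncn t)%N by rewrite truncn_gt0.
have /andP[h1 h2] := trunc_log_bounds (erefl : (1 < 2)%N) m0.
(* The exponent is the integer logarithm of the integer part [m] of [t]; the upper bound survives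
   because [t < m + 1 <= 2 ^ (k + 1)]. *)
exists (trunc_log 2 (Num.truncn t)); have /andP[t2 t3] := truncn_itv t0.
rewrite -!natrX; apply/andP; split.
  by apply: le_trans t2; rewrite ler_nat.
by apply: le_trans (ltW t3) _; rewrite ler_nat.
Qed.

Lemma dyadic_le1 (R : realType) (t : R) : 0 < t -> t <= 1 ->
  exists k : nat, 2^-1 ^+ k.+1 <= t <= 2^-1 ^+ k.
Proof.
move=> t0 t1; have [|k /andP[h1 h2]] := @dyadic_ge1 R t^-1.
  by rewrite invf_ge1.
exists k; rewrite !exprVn -[t]invrK !lef_pV2 ?posrE ?exprn_gt0 ?invr_gt0//.
by rewrite h2.
Qed.

(** The cofactor of [a - b] in [a ^+ n - b ^+ n] is a sum of [n] products of degree [n - 1], each at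
    most [c ^+ n.-1]. For [n = 0] both sides vanish. *)
Lemma ler_distXn (R : realType) (n : nat) (a b c : R) :
  0 <= a <= c -> 0 <= b <= c ->
  `|a ^+ n - b ^+ n| <= `|a - b| * (n%:R * c ^+ n.-1).
Proof.
case: n => [|m] /andP[a0 ac] /andP[b0 bc].
  by rewrite !expr0 subrr normr0 mul0r mulr0.
rewrite subrXX normrM ler_wpM2l// (le_trans (ler_norm_sum _ _ _))//.
rewrite /= -[X in X%:R * _]card_ord -sum1_card natr_sum mulr_suml.
rewrite ler_sum// => i _; rewrite mul1r normrM !normrX !ger0_norm// /= ?subSS.
have -> : c ^+ m = c ^+ (m - i) * c ^+ i.
  by rewrite -exprD subnK ?(leq_ord i).
by rewrite ler_pM ?exprn_ge0// lerXn2r ?nnegrE// (le_trans a0).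
Qed.

(** * Size and variation of the kernel [u / |u|^n] *)

Lemma enorm_scaled_le (R : realType) (n : nat) (u : 'rV[R]_n) (d : R) :
  0 < d -> d <= enorm u -> enorm (enorm u ^- n *: u) <= d ^- n.-1.
Proof.
move=> d0 du; have u0 : 0 < enorm u by exact: lt_le_trans du.
rewrite enormZ ger0_norm ?invr_ge0 ?exprn_ge0 ?enorm_ge0//.
case: n u du u0 => [|m] u du u0.
  by rewrite (_ : u = 0) ?enorm0 in u0; [rewrite ltxx in u0|apply/rowP => -[]].
rewrite exprS invfM mulrAC mulVf ?gt_eqF// mul1r /=.
by rewrite lef_pV2 ?posrE ?exprn_gt0// lerXn2r ?nnegrE ?enorm_ge0// ltW.
Qed.

(** An algebraic form of the mean value estimate. With [a = |u|] and [b = |v|], the difference is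
    [a^-n (u - v) + (a^-n - b^-n) v]. The first term gives the summand 1 of the constant. For the
    second, the hypothesis forces [a / 2 <= b <= 2 a], and each of these two bounds contributes a
    factor [2 ^ (n - 1)]. *)
Lemma enorm_scaled_sub_le (R : realType) (n : nat) (u v : 'rV[R]_n) :
  0 < enorm u -> 2 * enorm (u - v) <= enorm u ->
  enorm (enorm u ^- n *: u - enorm v ^- n *: v) <=
    (1 + n%:R * 4 ^+ n.-1) * enorm (u - v) * enorm u ^- n.
Proof.
set a := enorm u; set b := enorm v; set r := enorm (u - v) => a0 ra.
have /andP[ab1 ab2] : - r <= a - b <= r by rewrite -ler_norml lerB_enorm.
have b0 : 0 < b by lra.
have r0 : 0 <= r by exact: enorm_ge0.
rewrite (_ : _ - _ = a ^- n *: (u - v) + (a ^- n - b ^- n) *: v); last first.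
  by rewrite scalerBr scalerBl addrA subrK.
apply: le_trans (enormD _ _) _; rewrite !enormZ -/r -/b.
rewrite !mulrDl mul1r [`|a ^- n|]ger0_norm ?invr_ge0 ?exprn_ge0 ?(ltW a0)//.
rewrite [a ^- n * r]mulrC lerD2l.
have -> : a ^- n - b ^- n = (b ^+ n - a ^+ n) * (a ^- n * b ^- n).
  by field; rewrite !expf_neq0 ?gt_eqF.
rewrite normrM [`|a ^- n * _|]ger0_norm; last first.
  by rewrite mulr_ge0 ?invr_ge0 ?exprn_ge0 ?(ltW a0) ?(ltW b0).
have h : `|b ^+ n - a ^+ n| <= r * (n%:R * (2 * a) ^+ n.-1).
  apply: le_trans (@ler_distXn _ n b a (2 * a) _ _) _; [lra|lra|].
  have ba : `|b - a| <= r by rewrite ler_norml; lra.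
  by rewrite ler_wpM2r ?mulr_ge0 ?exprn_ge0 ?ler0n ?mulr_ge0 ?(ltW a0).
(* For [n > 0] the factor [b = |v|] cancels one power in [b ^- n]; for [n = 0] the difference of
   powers is zero. *)
case: n u v @a @b @r a0 ra ab1 ab2 b0 r0 h
  => [|m] u v a b r a0 ra ab1 ab2 b0 r0 h.
  by rewrite !expr0 subrr normr0 !(mul0r, mulr0).
rewrite /= in h *.
have -> : `|b ^+ m.+1 - a ^+ m.+1| * (a ^- m.+1 * b ^- m.+1) * b =
    `|b ^+ m.+1 - a ^+ m.+1| * (a ^- m.+1 * b ^- m).
  by rewrite [b ^+ m.+1]exprS; field; rewrite !expf_neq0 ?gt_eqF.
have h2 : b ^- m <= (2 / a) ^+ m.
  rewrite -exprVn lerXn2r ?nnegrE ?divr_ge0 ?invr_ge0 ?(ltW a0) ?(ltW b0)//.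
  by rewrite -[2 / a]invrK lef_pV2 ?posrE ?invr_gt0 ?divr_gt0// invf_div; lra.
apply: (@le_trans _ _
    (r * (m.+1%:R * (2 * a) ^+ m) * (a ^- m.+1 * (2 / a) ^+ m))).
  rewrite ler_pM ?mulr_ge0 ?invr_ge0 ?exprn_ge0 ?(ltW a0) ?(ltW b0)//.
  by rewrite ler_wpM2l ?invr_ge0 ?exprn_ge0 ?(ltW a0).
rewrite le_eqVlt; apply/orP; left; apply/eqP.
rewrite (_ : (4 : R) = 2 * 2); last by ring.
rewrite !exprMn exprVn; field.
by rewrite !expf_neq0 ?gt_eqF.
Qed.

(** * Coordinate bounds and linearity for the Clifford product *)

Lemma ler_norm_sum_card (R : realType) (I : finType) (P : pred I) (F : I -> R)
    (c : R) :
  0 <= c -> (forall i, `|F i| <= c) -> `|\sum_(i | P i) F i| <= #|I|%:R * c.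
Proof.
move=> c0 Fc; apply: le_trans (ler_norm_sum _ _ _) _.
apply: (@le_trans _ _ (\sum_(i : I) c)).
  rewrite [leRHS](bigID P)/= -[leLHS]addr0 lerD ?sumr_ge0//.
  by apply: ler_sum => i _.
by rewrite sumr_const mulr_natl.
Qed.

Lemma mvvec_le (R : realType) (n : nat) (v : 'rV[R]_n) (S : {set 'I_n}) :
  `|mvvec v S| <= n%:R * enorm v.
Proof.
rewrite /mvvec sum_ffunE -[X in X%:R * _]card_ord.
apply: ler_norm_sum_card => [|i]; first exact: enorm_ge0.
rewrite !ffunE normrM; apply: le_trans (coord_le_enorm v i).
by rewrite ler_piMr//; case: (_ == _); rewrite ?normr1 ?normr0.
Qed.

Section coordinate_bounds.
Context (R : realType) (n : nat) (u w : multivector R n) (a b : R).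
Hypotheses (ua : forall S, `|u S| <= a) (wb : forall S, `|w S| <= b).

Let a_ge0 : 0 <= a. Proof. exact: le_trans (ua finset.set0). Qed.
Let b_ge0 : 0 <= b. Proof. exact: le_trans (wb finset.set0). Qed.

Lemma mvinner_le : `|mvinner u w| <= #|{set 'I_n}|%:R * (a * b).
Proof.
apply: ler_norm_sum_card => [|S]; first by rewrite mulr_ge0.
by rewrite normrM ler_pM.
Qed.

Lemma wedge_le S : `|wedge u w S| <= #|{set 'I_n}|%:R * (a * b).
Proof.
rewrite ffunE; apply: ler_norm_sum_card => [|T]; first by rewrite mulr_ge0.
by rewrite !normrM normrX normrN1 expr1n mul1r ler_pM.
Qed.

End coordinate_bounds.

Lemma coord_le_mvnorm (R : realType) (n : nat) (w : multivector R n) S :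
  `|w S| <= mvnorm w.
Proof.
rewrite -sqrtr_sqr ler_wsqrtr// /mvinner (bigD1 S)//= -expr2 lerDl.
by rewrite sumr_ge0// => T _; rewrite -expr2 sqr_ge0.
Qed.

(** The sum of squares is at most [N * b ^+ 2], where [N] is the number of coordinates; since
    [N >= 1] this is at most [(N * b) ^+ 2], which keeps square roots out of the constants. *)
Lemma mvnorm_le (R : realType) (n : nat) (w : multivector R n) (b : R) :
  (forall S, `|w S| <= b) -> mvnorm w <= #|{set 'I_n}|%:R * b.
Proof.
move=> wb; have b0 : 0 <= b by exact: le_trans (wb finset.set0).
have Nb : 0 <= #|{set 'I_n}|%:R * b by rewrite mulr_ge0.
rewrite -[leRHS]ger0_norm// -sqrtr_sqr ler_wsqrtr//.
apply: le_trans (ler_norm _) (le_trans (mvinner_le wb wb) _).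
rewrite exprMn -!expr2 ler_wpM2r ?sqr_ge0// expr2 ler_peMr//.
by rewrite ler1n; apply/card_gt0P; exists finset.set0.
Qed.

Lemma clifford_le (R : realType) (n : nat) : exists2 c : R, 0 <= c &
  forall (v : 'rV[R]_n) (w : multivector R n) S,
    `|clifford v w S| <= c * (enorm v * mvnorm w).
Proof.
pose N : R := #|{set 'I_n}|%:R.
(* The contraction is an inner product with a wedge product, hence two factors [N]; the wedge
   product costs one. Each [n%:R] comes from [mvvec_le]. *)
exists (N * N * n%:R + N * n%:R) => [|v w S].
  by rewrite addr_ge0 ?mulr_ge0 ?ler0n.
rewrite /clifford ffunE (le_trans (ler_normD _ _))//.
have eS T : `|mvbasis R S T| <= 1.
  by rewrite ffunE; case: (_ == _); rewrite ?normr1 ?normr0.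
have h1 := mvinner_le (coord_le_mvnorm w) (wedge_le (mvvec_le v) eS).
have h2 := wedge_le (mvvec_le v) (coord_le_mvnorm w) S.
rewrite ffunE; apply: le_trans (lerD h1 h2) _; rewrite -/N le_eqVlt.
by apply/orP; left; apply/eqP; ring.
Qed.

(** Linearity in the vector lets integrands with a common base point telescope when a Cauchy
    transform is constructed. *)
Lemma clifford_subl (R : realType) (n : nat) (v v' : 'rV[R]_n)
    (w : multivector R n) :
  clifford (v - v') w = clifford v w - clifford v' w.
Proof.
have vec S : mvvec (v - v') S = mvvec v S - mvvec v' S.
  rewrite /mvvec !sum_ffunE -sumrB; apply: eq_bigr => i _.
  by rewrite !ffunE !mxE scalerBl.
have wed w' S : wedge (mvvec (v - v')) w' S =
    wedge (mvvec v) w' S - wedge (mvvec v') w' S.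
  rewrite !ffunE -sumrB; apply: eq_bigr => T _.
  by rewrite vec mulrBr mulrBl.
have con (S : {set 'I_n}) : Defs.contraction (mvvec (v - v')) w S =
    Defs.contraction (mvvec v) w S - Defs.contraction (mvvec v') w S.
  rewrite !ffunE -sumrB; apply: eq_bigr => T _.
  by rewrite wed mulrBr.
apply/ffunP => S; transitivity (
    Defs.contraction (mvvec v) w S + wedge (mvvec v) w S -
    (Defs.contraction (mvvec v') w S + wedge (mvvec v') w S)).
  by rewrite /clifford ffunE con wed opprD addrACA.
by rewrite !ffunE.
Qed.

(** * Measurability of norms, products and kernels *)

Section measurable_multivector.
Context d (T : measurableType d) (R : realType) (n : nat).

Lemma measurable_sum_cond (I : finType) (P : pred I) (h : I -> T -> R) :
  (forall i, measurable_fun setT (h i)) ->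
  measurable_fun setT (fun x => \sum_(i | P i) h i x).
Proof.
by move=> mh; under eq_fun do rewrite -big_filter; exact: measurable_sum.
Qed.

Lemma measurable_enorm (v : T -> 'rV[R]_n) :
  (forall i, measurable_fun setT (fun x => v x ord0 i : R)) ->
  measurable_fun setT (fun x => enorm (v x)).
Proof.
(* The square root of a nonnegative sum is its real power of exponent 1/2, and real powers are
   measurable. *)
move=> mv; rewrite (_ : (fun y => _) =
    (@powR R ^~ 2^-1) \o (fun y => \sum_(i < n) v y ord0 i ^+ 2)); last first.
  apply/funext => y /=; rewrite powR12_sqrt// sumr_ge0// => i _.
  exact: sqr_ge0.
apply: measurableT_comp; first exact: measurable_powR.
by apply: measurable_sum => i; exact: measurable_funX.
Qed.

Lemma measurable_wedge (u w : T -> multivector R n) :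
  (forall S, measurable_fun setT (fun x => u x S : R)) ->
  (forall S, measurable_fun setT (fun x => w x S : R)) ->
  forall S, measurable_fun setT (fun x => wedge (u x) (w x) S : R).
Proof.
move=> mu mw S; under eq_fun do rewrite ffunE.
apply: measurable_sum_cond => A; apply: measurable_funM => //.
by apply: measurable_funM.
Qed.

Lemma measurable_mvinner (u w : T -> multivector R n) :
  (forall S, measurable_fun setT (fun x => u x S : R)) ->
  (forall S, measurable_fun setT (fun x => w x S : R)) ->
  measurable_fun setT (fun x => mvinner (u x) (w x)).
Proof.
by move=> mu mw; apply: measurable_sum_cond => S; exact: measurable_funM.
Qed.

Lemma measurable_clifford (v : T -> 'rV[R]_n) (w : T -> multivector R n) :
  (forall i, measurable_fun setT (fun x => v x ord0 i : R)) ->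
  (forall S, measurable_fun setT (fun x => w x S : R)) ->
  forall S, measurable_fun setT (fun x => clifford (v x) (w x) S : R).
Proof.
move=> mv mw S.
have mvec A : measurable_fun setT (fun x => mvvec (v x) A : R).
  under eq_fun do rewrite /mvvec sum_ffunE.
  apply: measurable_sum_cond => i; under eq_fun do rewrite ffunE.
  by apply: measurable_funM.
rewrite /clifford; under eq_fun do rewrite ffunE.
apply: measurable_funD; last exact: measurable_wedge.
under eq_fun do rewrite ffunE.
apply: measurable_mvinner => // A; exact: measurable_wedge.
Qed.

End measurable_multivector.

Lemma measurable_coordB (R : realType) (n : nat) (x : 'rV[R]_n) (i : 'I_n) :
  measurable_fun setT (fun y : 'rV[R]_n => (y - x) ord0 i : R).
Proof.
under eq_fun do rewrite !mxE.
by apply: measurable_funB => //; exact: (measurable_rV_coord i).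
Qed.

Lemma measurable_enormB (R : realType) (n : nat) (x : 'rV[R]_n) :
  measurable_fun setT (fun y : 'rV[R]_n => enorm (y - x)).
Proof. by apply: measurable_enorm => i; exact: measurable_coordB. Qed.

Lemma measurable_cauchy_kernel (R : realType) (n : nat) (x : 'rV[R]_n)
    (i : 'I_n) :
  measurable_fun setT (fun y => cauchy_kernel x y ord0 i : R).
Proof.
under eq_fun do rewrite mxE.
apply: measurable_funM; last exact: measurable_coordB.
(* The inverse is the real power of exponent -1, also at 0, where both take the value 0. *)
rewrite (_ : (fun y => _) =
    (@powR R ^~ (-1)) \o (fun y => enorm (y - x) ^+ n)); last first.
  by apply/funext => y /=; rewrite powR_inv1// exprn_ge0// enorm_ge0.
apply: measurableT_comp; first exact: measurable_powR.
by apply: measurable_funX; exact: measurable_enormB.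
Qed.

Lemma measurable_cauchy_kernelB (R : realType) (n : nat)
    (x x' : 'rV[R]_n) (i : 'I_n) :
  measurable_fun setT
    (fun y => (cauchy_kernel x y - cauchy_kernel x' y) ord0 i : R).
Proof.
under eq_fun do rewrite mxE [X in _ + X]mxE.
by apply: measurable_funB; exact: measurable_cauchy_kernel.
Qed.

(** * Volume of balls and integrals over them *)

Definition eball (R : realType) (n : nat) (x : 'rV[R]_n) (r : R) :
  set 'rV[R]_n := [set y | enorm (y - x) <= r].

Lemma measurable_eball (R : realType) (n : nat) (x : 'rV[R]_n) (r : R) :
  measurable (eball x r).
Proof.
have := measurable_enormB x measurableT (measurable_itv `]-oo, r]).
by rewrite setTI; congr measurable.
Qed.

(** The ball lies in the cube of side [2 * r] with the same centre, whose volume is given by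
    [lebesgue_rV_box]. *)
Lemma lebesgue_eball_le (R : realType) (n : nat) (x : 'rV[R]_n) (r : R) :
  0 <= r -> (lebesgue_rV R n (eball x r) <= ((2 * r) ^+ n)%:E)%E.
Proof.
move=> r0.
pose A (i : 'I_n) : set (measurableTypeR R) :=
  [set` `[x ord0 i - r, x ord0 i + r]].
have mA i : measurable (A i) by exact: measurable_itv.
have -> : ((2 * r) ^+ n)%:E =
    lebesgue_rV R n [set y | forall i, A i (y ord0 i)].
  rewrite lebesgue_rV_box// (eq_bigr (fun=> (2 * r)%:E)); last first.
    move=> i _; rewrite /A lebesgue_measure_itv/= lte_fin.
    case: ifPn => [_|]; first by rewrite -EFinD; congr EFin; ring.
    (* Here the interval is degenerate: [r = 0], so its length 0 is still [2 * r]. *)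
    rewrite -leNgt => h; congr EFin; lra.
  by rewrite prodEFin prodr_const card_ord.
apply: le_measure; rewrite ?inE; first exact: measurable_eball.
  rewrite [X in measurable X](_ : _ =
      \bigcap_(i in [set: 'I_n]) (@rV_coord R n i @^-1` A i)).
    apply: fin_bigcap_measurable => //= i _.
    by rewrite -[X in measurable X]setTI; exact: measurable_rV_coord.
  by apply/seteqP; split=> y /= Ay; [move=> i _; exact: Ay|move=> i; exact: Ay].
move=> y yr i; rewrite /A/= in_itv/=.
have := le_trans (coord_le_enorm (y - x) i) yr.
by rewrite !mxE ler_norml => /andP[h1 h2]; apply/andP; split; lra.
Qed.

(** Hoelder's inequality for [f] and the indicator of the ball. The bound on the volume is uniform
    in the centre, so [M] depends on neither [x] nor [r]; the exponent is [n / q] with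
    [1 / q = 1 - 1 / p]. *)
Lemma integral_eball_le (R : realType) (n : nat) (p : R) (f : 'rV[R]_n -> R) :
  1 < p -> (forall y, 0 <= f y) -> f \in Lfun (lebesgue_rV R n) p%:E ->
  exists2 M : R, 0 <= M & forall x r, 0 < r ->
    (\int[lebesgue_rV R n]_y (f y * \1_(eball x r) y)%:E <=
      (M * r `^ (n%:R - n%:R / p))%:E)%E.
Proof.
move=> p1 f0; rewrite inE => /andP[/= mf ffin].
have {}mf : measurable_fun setT f by rewrite inE in mf.
rewrite inE /= /finite_norm in ffin.
set Nf := Lnorm _ _ _ in ffin.
have Nf0 : (0 <= Nf)%E by exact: Lnorm_ge0.
have NfE : Nf = (fine Nf)%:E by rewrite fineK// ge0_fin_numE.
have p0 : 0 < p by lra.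
have pV1 : p^-1 < 1 by rewrite invf_lt1.
pose q := (1 - p^-1)^-1.
have q0 : 0 < q by rewrite invr_gt0 subr_gt0.
exists (fine Nf * 2 `^ (n%:R / q)) => [|x r r0].
  by rewrite mulr_ge0 ?powR_ge0// fine_ge0.
have mB := measurable_eball x r.
have m1 : measurable_fun setT (\1_(eball x r) : 'rV[R]_n -> R).
  exact: measurable_indic.
have := hoelder (lebesgue_rV R n) mf m1 p0 q0.
rewrite -/Nf /q invrK subrKC => /(_ erefl).
rewrite Lnorm1 -/q => h.
apply: le_trans (le_trans h _).
  rewrite le_eqVlt; apply/orP; left; apply/eqP; apply: eq_integral => y _.
  by rewrite /= ger0_norm// mulr_ge0.
rewrite NfE -mulrA EFinM lee_wpmul2l ?lee_fin ?fine_ge0//.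
rewrite unlock.
(* An indicator equals its own [q]-th power because [q > 0], so its [q]-norm is the volume of the
   ball to the power [1 / q]. *)
under eq_integral.
  move=> y _.
  rewrite (_ : _ `^ _ = (\1_(eball x r) y)%:E)%E; last first.
    rewrite /= indicE; case: (_ \in _); rewrite ?normr1 ?normr0 ?powR1//.
    by rewrite powR0// gt_eqF.
  over.
rewrite integral_indic// setIT.
apply: (@le_trans _ _ (((2 * r) ^+ n)%:E `^ q^-1)%E).
  apply: gt0_ler_poweR.
  - by rewrite invr_ge0 ltW.
  - by rewrite in_itv/= leey measure_ge0.
  - by rewrite in_itv/= leey lee_fin exprn_ge0// mulr_ge0// ltW.
  - by rewrite lebesgue_eball_le// ltW.
rewrite poweR_EFin lee_fin -powR_mulrn ?mulr_ge0 ?(ltW r0)// -powRrM.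
by rewrite powRM ?(ltW r0)// /q invrK mulrBr mulr1.
Qed.

(** * Series over dyadic shells *)

(* A point y of the shell rho s^k / 2 <= |y - x| <= rho s^k sees the value
   d (rho s^k / 2)^(-m), an upper bound of d |y - x|^(-m); the indicator is that
   of the whole ball, which only increases the sum. *)
Definition shell_series (R : realType) (n : nat) (f : 'rV[R]_n -> R)
    (x : 'rV[R]_n) (d s rho : R) (m : nat) (y : 'rV[R]_n) : \bar R :=
  (\sum_(0 <= k <oo) (d * (rho * s ^+ k / 2) ^- m *
    (f y * \1_(eball x (rho * s ^+ k)) y))%:E)%E.

Section shell_series.
Context (R : realType) (n : nat) (f : 'rV[R]_n -> R) (x : 'rV[R]_n).
Context (d s rho : R) (m : nat).
Hypotheses (f0 : forall y, 0 <= f y).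
Hypotheses (d0 : 0 <= d) (s0 : 0 < s) (rho0 : 0 < rho).

Let radius_gt0 k : 0 < rho * s ^+ k.
Proof. by rewrite mulr_gt0// exprn_gt0. Qed.

Let shell_ge0 k y : 0 <= d * (rho * s ^+ k / 2) ^- m *
  (f y * \1_(eball x (rho * s ^+ k)) y).
Proof.
by rewrite !mulr_ge0// invr_ge0 exprn_ge0// divr_ge0// ltW.
Qed.

Lemma shell_series_ge0 y : (0 <= shell_series f x d s rho m y)%E.
Proof. by apply: nneseries_ge0 => k _ _; rewrite lee_fin. Qed.

Lemma shell_series_ge (y : 'rV[R]_n) (h : R) (k : nat) :
  enorm (y - x) <= rho * s ^+ k -> h <= d * (rho * s ^+ k / 2) ^- m ->
  ((h * f y)%:E <= shell_series f x d s rho m y)%E.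
Proof.
move=> yx hk; apply: (@le_trans _ _ ((d * (rho * s ^+ k / 2) ^- m *
    (f y * \1_(eball x (rho * s ^+ k)) y))%:E)).
  by rewrite lee_fin indicE mem_set// mulr1 ler_wpM2r.
apply: le_trans (nneseries_lim_ge k.+1 _) => [|i _ _]; last by rewrite lee_fin.
rewrite big_nat_recr//= leeDr// sume_ge0// => i _.
by rewrite lee_fin.
Qed.

Hypothesis mf : measurable_fun setT f.

Let measurable_shell k : measurable_fun setT (fun y =>
  (d * (rho * s ^+ k / 2) ^- m * (f y * \1_(eball x (rho * s ^+ k)) y))%:E).
Proof.
apply/measurable_EFinP; apply: measurable_funM => //.
apply: measurable_funM => //; apply: measurable_indic.
exact: measurable_eball.
Qed.

Lemma measurable_shell_series :
  measurable_fun setT (shell_series f x d s rho m).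
Proof.
by apply: ge0_emeasurable_sum => [k y _ _|k _] //; rewrite lee_fin.
Qed.

(** Sum and integral commute for nonnegative terms, and the [k]-th integral is at most a constant
    times [theta ^+ k] with [theta = s ^ (beta - m)]. Shrinking radii ([s < 1]) therefore call for
    [beta > m], growing ones ([s > 1]) for [beta < m]. *)
Lemma integral_shell_series_le (beta M : R) :
  0 <= M -> s `^ (beta - m%:R) < 1 ->
  (forall r, 0 < r -> (\int[lebesgue_rV R n]_y (f y * \1_(eball x r) y)%:E <=
      (M * r `^ beta)%:E)%E) ->
  (\int[lebesgue_rV R n]_y shell_series f x d s rho m y <=
    (d * M * 2 ^+ m * rho `^ (beta - m%:R) / (1 - s `^ (beta - m%:R)))%:E)%E.
Proof.
move=> M0 theta1 hM; set theta := s `^ _ in theta1 *.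
have theta0 : 0 < theta by exact: powR_gt0.
set A := d * M * 2 ^+ m * rho `^ _.
have A0 : 0 <= A by rewrite !mulr_ge0// ?exprn_ge0// powR_ge0.
rewrite integral_nneseries//; last by move=> k y _; rewrite lee_fin.
apply: (@le_trans _ _ (\sum_(0 <= k <oo) (A * theta ^+ k)%:E)%E).
  apply: lee_nneseries => [k _ _|k _].
    by apply: integral_ge0 => y _; rewrite lee_fin.
  have c0 : 0 <= d * (rho * s ^+ k / 2) ^- m.
    by rewrite mulr_ge0// invr_ge0 exprn_ge0// divr_ge0// ltW.
  under eq_integral do rewrite EFinM.
  rewrite ge0_integralZl//; last 2 first.
  - apply/measurable_EFinP; apply: measurable_funM => //.
    by apply: measurable_indic; exact: measurable_eball.
  - by move=> y _; rewrite lee_fin mulr_ge0.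
  apply: le_trans (lee_wpmul2l _ (hM _ (radius_gt0 k))) _.
    by rewrite lee_fin.
  (* The two sides are equal: [2 ^+ m] comes from halving the radius, and the remaining powers of
     [rho * s ^+ k] combine to the exponent [beta - m]. *)
  rewrite -EFinM lee_fin le_eqVlt; apply/orP; left; apply/eqP.
  rewrite /A /theta.
  have -> : s `^ (beta - m%:R) ^+ k = (s ^+ k) `^ (beta - m%:R).
    by rewrite -(powR_mulrn k (powR_ge0 _ _)) powRAC powR_mulrn// ltW.
  rewrite -[RHS]mulrA -powRM ?exprn_ge0 ?(ltW s0) ?(ltW rho0)//.
  rewrite powRB; last by rewrite (gt_eqF (radius_gt0 k)) implybT.
  rewrite powR_mulrn ?(ltW (radius_gt0 k))// expr_div_n invf_div.
  by field; rewrite expf_neq0// gt_eqF.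
apply: lime_le.
  apply: is_cvg_nneseries => k _ _.
  by rewrite lee_fin mulr_ge0// exprn_ge0// ltW.
apply: nearW => N; rewrite sumEFin lee_fin.
by apply: geometric_le_lim => //; rewrite ger0_norm ?ltW.
Qed.

End shell_series.

(** * Pointwise domination of the kernels by shell series *)

Section kernel_shells.
Context (R : realType) (n : nat) (f : 'rV[R]_n -> R) (r : R).
Hypotheses (f0 : forall y, 0 <= f y) (r0 : 0 < r).

Lemma cauchy_kernel_le_shells (x y : 'rV[R]_n) : enorm (y - x) <= 4 * r ->
  ((enorm (cauchy_kernel x y) * f y)%:E <=
    shell_series f x 1 2^-1 (4 * r) n.-1 y)%E.
Proof.
(* The centre [y = x] lies in no shell, but there the kernel takes the value 0. *)
move=> yr; rewrite /cauchy_kernel; have [->|yx0] := eqVneq (y - x) 0.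
  by rewrite scaler0 enorm0 mul0r shell_series_ge0// mulr_gt0.
have a0 : 0 < enorm (y - x) by rewrite lt_neqAle eq_sym enorm_eq0 yx0 enorm_ge0.
have r40 : 0 < 4 * r by rewrite mulr_gt0.
have i20 : 0 < 2^-1 :> R by rewrite invr_gt0.
have [||k /andP[k1 k2]] := @dyadic_le1 R (enorm (y - x) / (4 * r)).
- by rewrite divr_gt0.
- by rewrite ler_pdivrMr// mul1r.
have ak : enorm (y - x) <= 4 * r * 2^-1 ^+ k.
  by rewrite mulrC -ler_pdivrMr.
apply: (shell_series_ge f0 _ i20 r40 ak) => //.
rewrite mul1r; apply: enorm_scaled_le.
  by rewrite divr_gt0// mulr_gt0// exprn_gt0.
by rewrite -mulrA -exprSr mulrC -ler_pdivlMr.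
Qed.

(** The cut is at [|y - x| = 2 r]. Beyond it the mean value estimate applies. Below it
    [|y - x'| < 3 r], so both kernels are controlled separately by their shells of radius at most
    [4 r]. *)
Lemma cauchy_kernel_sub_le_shells (x x' y : 'rV[R]_n) : enorm (x - x') = r ->
  ((enorm (cauchy_kernel x y - cauchy_kernel x' y) * f y)%:E <=
    shell_series f x 1 2^-1 (4 * r) n.-1 y +
    shell_series f x' 1 2^-1 (4 * r) n.-1 y +
    shell_series f x ((1 + n%:R * 4 ^+ n.-1) * r) 2 (4 * r) n y)%E.
Proof.
move=> xx'.
have r40 : 0 < 4 * r by rewrite mulr_gt0.
have C0 : 0 <= (1 + n%:R * 4 ^+ n.-1) * r.
  by rewrite mulr_ge0 ?(ltW r0)// addr_ge0// mulr_ge0// exprn_ge0.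
have S0 z s d m : 0 <= d -> 0 < s -> (0 <= shell_series f z d s (4 * r) m y)%E.
  by move=> d0 s0; exact: shell_series_ge0.
have i20 : 0 < 2^-1 :> R by rewrite invr_gt0.
have [far|near] := leP (2 * r) (enorm (y - x)).
  have a0 : 0 < enorm (y - x) by apply: lt_le_trans far; rewrite mulr_gt0.
  rewrite -[leLHS]add0e leeD ?adde_ge0 ?S0//.
  (* The inner radius of shell [k] is [2 r 2^k], half of the outer radius [4 r 2^k]; this is why the
     outer radii start at [4 r]. *)
  have [|k /andP[k1 k2]] := @dyadic_ge1 R (enorm (y - x) / (2 * r)).
    by rewrite ler_pdivlMr ?mul1r// mulr_gt0.
  rewrite ler_pdivlMr ?mulr_gt0// in k1.
  rewrite ler_pdivrMr ?mulr_gt0// exprS in k2.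
  have ak : enorm (y - x) <= 4 * r * 2 ^+ k.
    by apply: le_trans k2 _; rewrite le_eqVlt; apply/orP; left; apply/eqP; ring.
  have uv : enorm (y - x - (y - x')) = r.
    rewrite -xx' enorm_distC; congr enorm.
    by rewrite opprB addrC subrKA.
  apply: (shell_series_ge f0 C0 _ r40 ak) => //.
  apply: le_trans (@enorm_scaled_sub_le _ n (y - x) (y - x') a0 _) _.
    by rewrite uv.
  rewrite uv ler_wpM2l// lef_pV2 ?posrE ?exprn_gt0//; last first.
    by rewrite divr_gt0// mulr_gt0// exprn_gt0.
  rewrite lerXn2r ?nnegrE ?divr_ge0 ?mulr_ge0 ?exprn_ge0 ?(ltW r0) ?(ltW a0)//.
  by rewrite (_ : _ / 2 = 2 ^+ k * (2 * r))//; field.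
rewrite -[leLHS]adde0 leeD ?S0//.
apply: (@le_trans _ _ ((enorm (cauchy_kernel x y) * f y)%:E +
    (enorm (cauchy_kernel x' y) * f y)%:E)%E).
  rewrite -EFinD lee_fin -mulrDl ler_wpM2r//.
  by rewrite -[enorm (cauchy_kernel x' y)]enormN enormD.
apply: leeD; apply: cauchy_kernel_le_shells; first by lra.
have := enormD (y - x) (x - x'); rewrite addrA subrK xx'; lra.
Qed.

End kernel_shells.

(** * The integral of the kernel difference *)

Lemma integral_cauchy_kernel_sub_le (R : realType) (n : nat) (p : R)
    (f : 'rV[R]_n -> R) :
  (0 < n)%N -> n%:R < p -> measurable_fun setT f -> (forall y, 0 <= f y) ->
  f \in Lfun (lebesgue_rV R n) p%:E ->
  exists2 A : R, 0 <= A & forall x x' : 'rV[R]_n,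
    (\int[lebesgue_rV R n]_y
      (enorm (cauchy_kernel x y - cauchy_kernel x' y) * f y)%:E <=
    (A * enorm (x - x') `^ (1 - n%:R / p))%:E)%E.
Proof.
move=> n0 np mf f0 fLp.
have n1 : 1 <= n%:R :> R by rewrite ler1n.
have p0 : 0 < p by lra.
have np1 : n%:R / p < 1 by rewrite ltr_pdivrMr ?mul1r.
have np0 : 0 < n%:R / p by rewrite divr_gt0//; lra.
have [|M M0 hM] := integral_eball_le _ f0 fLp; first by lra.
set a := 1 - n%:R / p.
have half_lt1 e : 0 < e -> 2^-1 `^ e < 1 :> R.
  move=> e0; rewrite [ltRHS](_ : _ = 1 `^ e); last by rewrite powR1.
  rewrite gt0_ltr_powR ?nnegrE//.
  by rewrite invf_lt1// ltr1n.
(* The two geometric ratios, with [beta = n - n / p]: near the poles [m = n - 1] gives the exponent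
   [a > 0], far away [m = n] gives [a - 1 = - n / p < 0]. *)
pose th1 : R := 2^-1 `^ a; pose th2 : R := 2 `^ (a - 1).
have th11 : th1 < 1 by apply: half_lt1; rewrite subr_gt0.
have th21 : th2 < 1.
  rewrite /th2 (_ : a - 1 = -1 * (n%:R / p)); last by rewrite /a; ring.
  by rewrite powRrM powR_inv1// half_lt1.
pose C : R := 1 + n%:R * 4 ^+ n.-1.
have C0 : 0 <= C by rewrite addr_ge0// mulr_ge0// exprn_ge0.
pose A1 := M * 2 ^+ n.-1 / (1 - th1).
(* In the far series the coefficient [C * r] meets [(4 r) ^ (a - 1) = (4 r) ^ a / (4 r)]: the factor
   [r] cancels and 1/4 remains. *)
pose A2 := C * M * 2 ^+ n / (1 - th2) / 4.
have A10 : 0 <= A1 by rewrite !mulr_ge0 ?exprn_ge0// invr_ge0 subr_ge0 ltW.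
have A20 : 0 <= A2 by rewrite !mulr_ge0 ?exprn_ge0 ?invr_ge0 ?subr_ge0// ltW.
exists ((A1 + A1 + A2) * 4 `^ a) => [|x x'].
  by rewrite !mulr_ge0 ?powR_ge0// !addr_ge0.
(* The shells need [r > 0]; for equal points the integrand is identically zero. *)
have [->|xx'] := eqVneq x x'.
  rewrite integral0_eq => [|y _]; last by rewrite !subrr enorm0 mul0r.
  by rewrite lee_fin !mulr_ge0 ?powR_ge0// !addr_ge0.
have r0 : 0 < enorm (x - x').
  by rewrite lt_neqAle eq_sym enorm_eq0 subr_eq0 xx' enorm_ge0.
set r := enorm (x - x') in r0 *.
have r40 : 0 < 4 * r by rewrite mulr_gt0.
have Cr0 : 0 <= C * r by rewrite mulr_ge0// ltW.
have i20 : 0 < 2^-1 :> R by rewrite invr_gt0.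
have hn : n%:R - n%:R / p - n.-1%:R = a.
  by rewrite -subn1 natrB// /a; ring.
have hn' : n%:R - n%:R / p - n%:R = a - 1 by rewrite /a; ring.
have near z : (\int[lebesgue_rV R n]_y shell_series f z 1 2^-1 (4 * r) n.-1 y <=
    (A1 * (4 * r) `^ a)%:E)%E.
  apply: le_trans (integral_shell_series_le f0 _ _ _ mf M0 _ (hM z)) _ => //.
    by rewrite hn.
  by rewrite hn lee_fin mul1r /A1 /th1 [_ / _ * _]mulrAC.
have far : (\int[lebesgue_rV R n]_y shell_series f x (C * r) 2 (4 * r) n y <=
    (A2 * (4 * r) `^ a)%:E)%E.
  apply: le_trans (integral_shell_series_le f0 _ _ _ mf M0 _ (hM x)) _ => //.
    by rewrite hn'.
  rewrite hn' lee_fin le_eqVlt; apply/orP; left; apply/eqP.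
  rewrite -[X in _ = _ * X](mulr_powRB1 (ltW r40)) ?subr_gt0// /A2 -/th2.
  by field; rewrite subr_eq0 eq_sym lt_eqF.
have mshell z d s m : 0 <= d -> 0 < s ->
    measurable_fun setT (shell_series f z d s (4 * r) m).
  by move=> d0 s0; exact: measurable_shell_series.
have shell0 z d s m y : 0 <= d -> 0 < s ->
    (0 <= shell_series f z d s (4 * r) m y)%E.
  by move=> d0 s0; exact: shell_series_ge0.
apply: (@le_trans _ _ (\int[lebesgue_rV R n]_y
    (shell_series f x 1 2^-1 (4 * r) n.-1 y +
    shell_series f x' 1 2^-1 (4 * r) n.-1 y +
    shell_series f x (C * r) 2 (4 * r) n y))%E).
  apply: ge0_le_integral => //.
  - by move=> y _; rewrite lee_fin mulr_ge0 ?enorm_ge0.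
  - apply/measurable_EFinP; apply: measurable_funM => //.
    by apply: measurable_enorm => i; exact: measurable_cauchy_kernelB.
  - by apply: emeasurable_funD; [apply: emeasurable_funD|]; exact: mshell.
  - by move=> y _; exact: cauchy_kernel_sub_le_shells.
rewrite ge0_integralD//; last 4 first.
- by move=> y _; rewrite adde_ge0 ?shell0.
- by apply: emeasurable_funD; exact: mshell.
- by move=> y _; exact: shell0.
- exact: mshell.
rewrite ge0_integralD//; last 4 first.
- by move=> y _; exact: shell0.
- exact: mshell.
- by move=> y _; exact: shell0.
- exact: mshell.
rewrite -mulrA -powRM ?(ltW r0)// (mulrDl (A1 + A1)) (mulrDl A1) !EFinD.
exact: leeD (leeD (near x) (near x')) far.
Qed.

(** * Integrals of multivectors and Hölder continuity *)

Lemma dominated_Rintegral d (T : measurableType d) (R : realType)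
    (mu : {measure set T -> \bar R}) (h g : T -> R) (b : R) :
  measurable_fun setT h -> measurable_fun setT g -> (forall y, `|h y| <= g y) ->
  (\int[mu]_y (g y)%:E <= b%:E)%E ->
  mu.-integrable setT (EFin \o h) /\ `|\int[mu]_y h y| <= b.
Proof.
move=> mh mg hg gb.
have hb : (\int[mu]_y `|(h y)%:E| <= b%:E)%E.
  apply: le_trans gb; apply: ge0_le_integral => //.
  - by apply: measurableT_comp => //; exact/measurable_EFinP.
  - exact/measurable_EFinP.
  - by move=> y _; rewrite lee_fin.
have ih : mu.-integrable setT (EFin \o h).
  apply/integrableP; split; first exact/measurable_EFinP.
  by apply: le_lt_trans hb _; rewrite ltry.
split=> //; rewrite -lee_fin EFin_normr_Rintegral//.
apply: le_trans (le_abse_integral _ _ _) hb => //; exact/measurable_EFinP.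
Qed.

Lemma mvintegralE (R : realType) (n : nat) (h : 'rV[R]_n -> multivector R n) S :
  mvintegral h S = \int[lebesgue_rV R n]_y h y S.
Proof. by rewrite ffunE. Qed.

Lemma mvintegralB (R : realType) (n : nat) (h g : 'rV[R]_n -> multivector R n) :
  mvintegrable h -> mvintegrable g ->
  mvintegral h - mvintegral g = mvintegral (fun y => h y - g y).
Proof.
move=> ih ig; apply/ffunP => S; rewrite !ffunE -RintegralB//; last 2 first.
- exact: ih.
- exact: ig.
by apply: eq_Rintegral => y _; rewrite !ffunE.
Qed.

(** By [clifford_le], each coordinate of the integrand is dominated by a multiple of the kernel
    difference times [mvnorm (Phi y)]. The integral estimate then gives convergence and the Hölder
    bound together. *)
Lemma mvintegrable_cauchy_diff (R : realType) (n : nat) (p : R)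
    (Phi : 'rV[R]_n -> multivector R n) :
  (0 < n)%N -> n%:R < p -> mvLp p Phi ->
  exists2 B : R, 0 <= B & forall x x' : 'rV[R]_n,
    mvintegrable (cauchy_diff_integrand Phi x x') /\
    forall S, `|mvintegral (cauchy_diff_integrand Phi x x') S| <=
      B * enorm (x - x') `^ (1 - n%:R / p).
Proof.
move=> n0 np [mPhi PhiLp].
have f0 y : 0 <= mvnorm (Phi y) by exact: sqrtr_ge0.
have mf : measurable_fun setT (fun y => mvnorm (Phi y)).
  by move: PhiLp; rewrite inE => /andP[/= + _]; rewrite inE.
have [A A0 hA] := integral_cauchy_kernel_sub_le n0 np mf f0 PhiLp.
have [c c0 hc] := clifford_le R n.
exists (c * A) => [|x x']; first by rewrite mulr_ge0.
have main S : (lebesgue_rV R n).-integrable setT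
      (EFin \o (fun y => cauchy_diff_integrand Phi x x' y S)) /\
    `|\int[lebesgue_rV R n]_y cauchy_diff_integrand Phi x x' y S| <=
      c * A * enorm (x - x') `^ (1 - n%:R / p).
  pose g y := enorm (cauchy_kernel x y - cauchy_kernel x' y) * mvnorm (Phi y).
  have mg : measurable_fun setT g.
    apply: measurable_funM => //; apply: measurable_enorm => i.
    exact: measurable_cauchy_kernelB.
  apply: (@dominated_Rintegral _ _ _ _ _ (fun y => c * g y)).
  - by apply: measurable_clifford => // i; exact: measurable_cauchy_kernelB.
  - exact: measurable_funM.
  - by move=> y; exact: hc.
  under eq_integral do rewrite EFinM.
  rewrite ge0_integralZl//; last 2 first.
  - exact/measurable_EFinP.
  - by move=> y _; rewrite lee_fin mulr_ge0 ?enorm_ge0.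
  by rewrite -mulrA [leRHS]EFinM lee_wpmul2l// hA.
by split=> S; [have [] := main S|rewrite mvintegralE; have [] := main S].
Qed.

Theorem proposition7p1 (R : realType) (n : nat) (p : R)
    (Phi : 'rV[R]_n -> multivector R n) :
  (2 < n)%N -> n%:R < p -> mvLp p Phi ->
  (exists F, is_cauchy_transform Phi F) /\
  (forall F, is_cauchy_transform Phi F -> holder_continuous (1 - n%:R / p) F).
Proof.
move=> n2 np PhiLp; have n0 : (0 < n)%N by exact: leq_trans n2.
have [B B0 hB] := mvintegrable_cauchy_diff n0 np PhiLp.
split=> [|F hF].
  (* The additive constant is fixed by taking 0 as base point, so that this representative vanishes
     at the origin. *)
  exists (fun x =>
    (sphere_area R n)^-1 *: mvintegral (cauchy_diff_integrand Phi x 0)).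
  move=> x x'; split; first by have [] := hB x x'.
  have [ix _] := hB x 0; have [ix' _] := hB x' 0.
  rewrite -scalerBr mvintegralB//; congr (_ *: mvintegral _).
  (* The kernel with pole 0 cancels between the two integrands. *)
  apply/funext => y; rewrite /cauchy_diff_integrand -clifford_subl.
  by congr clifford; rewrite opprB addrA subrK.
(* The cardinal comes from passing from coordinates to the norm by [mvnorm_le], and [B] bounds each
   coordinate of the integral. *)
exists (#|{set 'I_n}|%:R * (`|(sphere_area R n)^-1| * B)) => x x'.
rewrite -mulrA -mulrA; apply: mvnorm_le => S.
have [_ ->] := hF x x'; have [_ hb] := hB x x'.
by rewrite ffunE normrM ler_wpM2l.
Qed.
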